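(* Let $F$ be a Lozi-like map defined by a pair of synchronously hyperbolic $C^1$ diffeomorphisms $F_1,F_2$ and a divider $\Gamma$, with the attractor $\Lambda$. Then for every $\bar p\in\Sigma_\Lambda$ there exists only one point $P\in\Lambda$ with itinerary $\bar p$.
   Context: ''Smooth'' means of class $C^1$. A cone in $\mathbb{R}^2$ is a set $K=\{\mathbf{u}: |\mathbf{u}\cdot\mathbf{v}|\ge \ell\|\mathbf{u}\|\}$ given by a unit vector $\mathbf{v}$ and $\ell\in(0,1)$; its axis is $\{t\mathbf{v}:t\in\mathbb{R}\}$. Two cones are disjoint if they intersect only in $\mathbf{0}$. A pair of cones $K^u,K^s$ is universal if they are disjoint, the axis of $K^u$ is the $x$-axis and the axis of $K^s$ is the $y$-axis. A cone field on an open set $U\subseteq\mathbb{R}^2$ assigns to each $P\in U$ a cone $K_P$ whose axis $\mathbf{v}(P)$ and coefficient $\ell(P)$ vary continuously with $P$. A smooth curve with all tangent vectors in a cone with axis the $x$-axis (resp. $y$-axis) is a graph $y=f(x)$ (resp. $x=f(y)$); it is infinite in both directions if the domain of $f$ is $\mathbb{R}$. $C^1$ diffeomorphisms $F_1,F_2:\mathbb{R}^2\to\mathbb{R}^2$ are synchronously hyperbolic if they are either both orientation reversing or both orientation preserving, and there exist $\lambda>1$ (the stretching factor), a universal pair of cones $K^u,K^s$, and cone fields $(K^u_P)_{P\in\mathbb{R}^2}$, $(K^s_P)_{P\in\mathbb{R}^2}$ such that: (S1) for every $P\in\mathbb{R}^2$ and $i=1,2$: $K^u_P\subset K^u$, $K^s_P\subset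 K^s$, $(DF_i)_P(K^u_P)\subset K^u_{F_i(P)}$, and $(DF_i^{-1})_P(K^s_P)\subset K^s_{F_i^{-1}(P)}$; (S2) for every $P$ and $i=1,2$: $\|(DF_i)_P(\mathbf{u})\|\ge\lambda\|\mathbf{u}\|$ for $\mathbf{u}\in K^u_P$ and $\|(DF_i^{-1})_P(\mathbf{w})\|\ge\lambda\|\mathbf{w}\|$ for $\mathbf{w}\in K^s_P$; (S3) there is a smooth curve $\Gamma\subset\mathbb{R}^2$, infinite in both directions, such that for every $P\in\Gamma$ we have $F_1(P)=F_2(P)$, the vector tangent to $\Gamma$ at $P$ belongs to $K^s_P$, and the vector tangent to $F_i(\Gamma)$ at $F_i(P)$ belongs to $K^u_{F_i(P)}$. $\Gamma$ is called the divider; it divides the plane into the left half-plane and the right half-plane, and $F_1(\Gamma)=F_2(\Gamma)$ divides the plane into the upper half-plane and the lower half-plane (each half-plane is taken with its boundary curve). Without loss of generality $F_1$ and $F_2$ map the left half-plane onto the lower one and the right half-plane onto the upper one; this is a standing convention. A trapping region for a map is a nonempty set that is mapped with its closure into its interior. Given synchronously hyperbolic $F_1,F_2$ with divider $\Gamma$, let $F(P)=F_1(P)$ for $P$ in the left half-plane and $F(P)=F_2(P)$ for $P$ in the right half-plane. $F$ (a homeomorphism of $\mathbb{R}^2$) is called Lozi-like if (L1) $-1<\det DF_i(P)<0$ for every $P\in\mathbb{R}^2$ and $i=1,2$; and (L2) there exists a trapping region $\Delta$ for $F$ which is homeomorphic to an open disk and whose closure is homeomorphic to a closed disk. ''With the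 attractor $\Lambda$'' means that $\Lambda=\bigcap_{n=0}^\infty F^n(\Delta)$ and $F|_\Lambda$ is topologically transitive. Coding: to a point $P\in\Lambda$ one assigns a bi-infinite sequence $\bar p=(p_n)_{n\in\mathbb{Z}}$ of signs $+$ and $-$ such that $p_n=-$ if $F^n(P)$ is in the left half-plane and $p_n=+$ if $F^n(P)$ is in the right half-plane; when $F^n(P)\in\Gamma$ both choices are allowed, so a point may have more than one such sequence. Any such sequence is called an itinerary of $P$. A bi-infinite sequence is admissible if it is an itinerary of some point of $\Lambda$; $\Sigma_\Lambda$ is the set of all admissible sequences. *)

(* Defs.v *)
From HB Require Import structures.
From mathcomp Require Import all_boot all_order all_algebra.
From mathcomp Require Import all_classical all_reals all_analysis.

Set Implicit Arguments.
Unset Strict Implicit.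
Unset Printing Implicit Defensive.

Import Order.TTheory GRing.Theory Num.Theory.
Import numFieldNormedType.Exports.

Local Open Scope classical_set_scope.
Local Open Scope ring_scope.

(* Points and vectors of the plane are row vectors, with the topology of the
   library.  The norm `|u| of the library is the sup norm, hence the separate
   Euclidean norm [enorm]. *)
Definition plane (R : realType) := 'rV[R]_2.

Section Plane.
Variable R : realType.
Implicit Types (P Q u v : plane R) (A B C G D L : set (plane R)).

Definition xcoord P : R := P ord0 ord0.
Definition ycoord P : R := P ord0 ord_max.
Definition pt (x y : R) : plane R :=
  \row_(i < 2) if i == ord0 then x else y.

Definition dot u v : R := \sum_(i < 2) u ord0 i * v ord0 i.
Definition enorm u : R := Num.sqrt (dot u u).

Definition x_axis : set (plane R) := [set P | ycoord P = 0].
Definition y_axis : set (plane R) := [set P | xcoord P = 0].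

Record cone := Cone {
  cone_dir : plane R;
  cone_coef : R;
  cone_dir_unit : enorm cone_dir = 1;
  cone_coef_gt0 : 0 < cone_coef;
  cone_coef_lt1 : cone_coef < 1 }.

Definition cone_set (K : cone) : set (plane R) :=
  [set u | cone_coef K * enorm u <= `|dot u (cone_dir K)|].

Definition cone_axis (K : cone) : set (plane R) :=
  [set t *: cone_dir K | t in [set: R]].

Definition cones_disjoint (K1 K2 : cone) : Prop :=
  cone_set K1 `&` cone_set K2 = [set 0].

Definition universal_pair (Ku Ks : cone) : Prop :=
  [/\ cones_disjoint Ku Ks, cone_axis Ku = x_axis & cone_axis Ks = y_axis].

(* The direction of an axis is determined up to sign; on the simply connected
   plane a continuous field of axes has a continuous choice of unit
   directions, so asking for the latter is no restriction. *)
Definition cone_field (K : plane R -> cone) : Prop :=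
  continuous (fun P => cone_dir (K P)) /\
  continuous (fun P => cone_coef (K P)).

Definition C1_map (f : plane R -> plane R) : Prop :=
  (forall P, differentiable f P) /\ continuous (fun P => jacobian f P).

Record C1_diffeo := C1Diffeo {
  diffeo_map :> plane R -> plane R;
  diffeo_inv : plane R -> plane R;
  diffeo_mapK : cancel diffeo_map diffeo_inv;
  diffeo_invK : cancel diffeo_inv diffeo_map;
  diffeo_map_C1 : C1_map diffeo_map;
  diffeo_inv_C1 : C1_map diffeo_inv }.

Definition jac_det (f : plane R -> plane R) P : R := \det (jacobian f P).

Definition orientation_preserving (f : plane R -> plane R) : Prop :=
  forall P, 0 < jac_det f P.
Definition orientation_reversing (f : plane R -> plane R) : Prop :=
  forall P, jac_det f P < 0.

Definition C1_fun (f : R -> R) : Prop :=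
  (forall t, derivable f t 1) /\ continuous (derive1 f).

(* A smooth curve with all tangent vectors in a cone around the y-axis is a
   graph x = f(y); it is infinite in both directions when f is defined on the
   whole line. *)
Definition vertical_infinite_curve G : Prop :=
  exists2 f : R -> R, C1_fun f & G = [set pt (f y) y | y in [set: R]].

Definition tangent_vector G P u : Prop :=
  exists c : R -> plane R,
    [/\ c 0 = P, \forall t \near (0 : R), G (c t) & is_derive (0 : R) 1 c u].

(* Closed half-planes bounded by a curve that is a graph x = f(y) over the whole
   y-axis (left, right), or a graph y = f(x) over the whole x-axis (lower,
   upper). *)
Definition left_half G : set (plane R) :=
  [set P | exists Q, [/\ G Q, ycoord Q = ycoord P & xcoord P <= xcoord Q]].
Definition right_half G : set (plane R) :=
  [set P | exists Q, [/\ G Q, ycoord Q = ycoord P & xcoord Q <= xcoord P]].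
Definition lower_half G : set (plane R) :=
  [set P | exists Q, [/\ G Q, xcoord Q = xcoord P & ycoord P <= ycoord Q]].
Definition upper_half G : set (plane R) :=
  [set P | exists Q, [/\ G Q, xcoord Q = xcoord P & ycoord Q <= ycoord P]].

Definition cone_invariance (F : C1_diffeo) (Ku Ks : cone)
    (KuP KsP : plane R -> cone) : Prop :=
  forall P,
    [/\ cone_set (KuP P) `<=` cone_set Ku,
        cone_set (KsP P) `<=` cone_set Ks,
        'd F P @` cone_set (KuP P) `<=` cone_set (KuP (F P)) &
        'd (diffeo_inv F) P @` cone_set (KsP P) `<=` cone_set (KsP (diffeo_inv F P))].

Definition cone_expansion (F : C1_diffeo) (lambda : R)
    (KuP KsP : plane R -> cone) : Prop :=
  forall P,
    (forall u, cone_set (KuP P) u -> lambda * enorm u <= enorm ('d F P u)) /\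
    (forall w, cone_set (KsP P) w ->
       lambda * enorm w <= enorm ('d (diffeo_inv F) P w)).

Definition divider (F1 F2 : C1_diffeo) (KuP KsP : plane R -> cone) G : Prop :=
  vertical_infinite_curve G /\
  forall P, G P ->
    [/\ F1 P = F2 P,
        (forall u, tangent_vector G P u -> cone_set (KsP P) u),
        (forall u, tangent_vector (F1 @` G) (F1 P) u ->
           cone_set (KuP (F1 P)) u) &
        (forall u, tangent_vector (F2 @` G) (F2 P) u ->
           cone_set (KuP (F2 P)) u)].

Definition synchronously_hyperbolic (F1 F2 : C1_diffeo) G : Prop :=
  ((orientation_reversing F1 /\ orientation_reversing F2) \/
   (orientation_preserving F1 /\ orientation_preserving F2)) /\
  exists (lambda : R) (Ku Ks : cone) (KuP KsP : plane R -> cone),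
    [/\ 1 < lambda, universal_pair Ku Ks, cone_field KuP & cone_field KsP] /\
    [/\ cone_invariance F1 Ku Ks KuP KsP /\ cone_invariance F2 Ku Ks KuP KsP,
        cone_expansion F1 lambda KuP KsP /\ cone_expansion F2 lambda KuP KsP &
        divider F1 F2 KuP KsP G].

Definition half_plane_convention (F1 F2 : C1_diffeo) G : Prop :=
  [/\ F1 @` left_half G = lower_half (F1 @` G),
      F1 @` right_half G = upper_half (F1 @` G),
      F2 @` left_half G = lower_half (F2 @` G) &
      F2 @` right_half G = upper_half (F2 @` G)].

Definition pasted_map (F1 F2 : C1_diffeo) G (F : plane R -> plane R) : Prop :=
  (forall P, left_half G P -> F P = F1 P) /\
  (forall P, right_half G P -> F P = F2 P).

Definition trapping_region (F : plane R -> plane R) D : Prop :=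
  D !=set0 /\ F @` closure D `<=` interior D.

Definition homeomorphic A B : Prop :=
  exists f g : plane R -> plane R,
    [/\ {within A, continuous f}, {within B, continuous g},
        (forall P, A P -> B (f P) /\ g (f P) = P) &
        (forall Q, B Q -> A (g Q) /\ f (g Q) = Q)].

Definition open_disk : set (plane R) := [set P | enorm P < 1].
Definition closed_disk : set (plane R) := [set P | enorm P <= 1].

Definition disk_trapping_region (F : plane R -> plane R) D : Prop :=
  [/\ trapping_region F D, homeomorphic D open_disk &
      homeomorphic (closure D) closed_disk].

Definition lozi_like (F1 F2 : C1_diffeo) G (F : plane R -> plane R) : Prop :=
  [/\ synchronously_hyperbolic F1 F2 G, half_plane_convention F1 F2 G,
      pasted_map F1 F2 G F,
      (forall P, -1 < jac_det F1 P < 0 /\ -1 < jac_det F2 P < 0) &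
      exists D, disk_trapping_region F D].

Definition topologically_transitive (F : plane R -> plane R) L : Prop :=
  forall U V : set (plane R), open U -> open V ->
    L `&` U !=set0 -> L `&` V !=set0 ->
    exists n : nat, (iter n F @` (L `&` U)) `&` (L `&` V) !=set0.

Definition attractor (F : plane R -> plane R) L : Prop :=
  exists2 D, disk_trapping_region F D &
    L = \bigcap_(n in [set: nat]) (iter n F @` D) /\
    topologically_transitive F L.

(* For a bijective F, [pinv setT F] is the inverse of F. *)
Definition ziter (F : plane R -> plane R) (n : int) : plane R -> plane R :=
  match n with
  | Posz k => iter k F
  | Negz k => iter k.+1 (pinv setT F)
  end.

Variant sign := Minus | Plus.

Definition itinerary (F : plane R -> plane R) G (p : int -> sign) P : Prop :=
  forall n : int,
    match p n with
    | Minus => left_half G (ziter F n P)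
    | Plus => right_half G (ziter F n P)
    end.

Definition admissible (F : plane R -> plane R) G L : set (int -> sign) :=
  [set p | exists2 P, L P & itinerary F G p P].

End Plane.

(* Main.v *)
Require Import Defs.
From mathcomp Require Import all_boot all_order all_algebra.
From mathcomp Require Import all_classical all_reals all_analysis.
From mathcomp Require Import ring lra.

Set Implicit Arguments.
Unset Strict Implicit.
Unset Printing Implicit Defensive.

Import Order.TTheory GRing.Theory Num.Theory.
Import numFieldNormedType.Exports.

Local Open Scope classical_set_scope.
Local Open Scope ring_scope.

(** Let [P] and [Q] be points of the attractor with the same itinerary.  At every
    time the two orbits are moved by the same one of [F1] and [F2], and they stay
    in a bounded trapping region.  The uniqueness is therefore a statement about
    sequences of maps that are hyperbolic for common cone fields: if the forward
    orbits of [P] and [Q] under such a sequence are bounded, then [P - Q] lies in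
    the stable universal cone ([bounded_orbits_chord]).  Applied to the inverse
    maps this puts [P - Q] in the unstable universal cone as well, and the two
    cones meet only in [0].

    To prove [bounded_orbits_chord], let [f] be the composite of the first [n]
    maps.  The divider is tangent to the stable cones, hence so is its preimage
    under [f].  By Rolle's theorem a chord of a plane curve is parallel to one of
    its tangents, so the difference of two points of this preimage lies in the
    stable universal cone ([chord_in_cone]).  Both [P] and [Q] are within
    [O(lambda ^- n)] of the preimage ([near_pulled_back_curve]); since the cone
    is closed, [n -> oo] gives the claim.

    The distance estimate does not integrate the cone fields to invariant curves.
    It is a variational argument in the style of Ekeland
    ([transverse_intersection]): minimise [|f Q - c t| + kappa |Q - P|] over the
    points [Q] and the parameters [t] of the divider [c].  If [f Q] differed from
    [c t] at the minimum, one could decrease the first term by moving [Q] along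
    an unstable vector and moving [t]; as [f] expands unstable vectors by
    [lambda ^+ n], this costs less in the second term than it gains.

    For the inverse maps the role of the divider is played by its image, which is
    tangent to the unstable cones.  That the backward orbits stay in the trapping
    region uses the injectivity of [F]: the image of the divider is a graph over
    the x-axis, so the lower and upper half-planes meet only in it
    ([pasted_map_inj]). *)

(** * Coordinates, norms and cones of the plane *)

Section PlaneGeometry.
Variable R : realType.
Implicit Types (P Q u v : plane R) (K A B : set (plane R)).

Lemma ord2_cases (i : 'I_2) : i = ord0 \/ i = ord_max.
Proof. by case: i => -[|[|//]] i2; [left|right]; exact: val_inj. Qed.

Lemma planeP u v : xcoord u = xcoord v -> ycoord u = ycoord v -> u = v.
Proof.
by move=> hx hy; apply/rowP => i; case: (ord2_cases i) => ->.
Qed.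

Lemma xcoordD u v : xcoord (u + v) = xcoord u + xcoord v.
Proof. by rewrite /xcoord mxE. Qed.

Lemma ycoordD u v : ycoord (u + v) = ycoord u + ycoord v.
Proof. by rewrite /ycoord mxE. Qed.

Lemma xcoordN u : xcoord (- u) = - xcoord u.
Proof. by rewrite /xcoord mxE. Qed.

Lemma ycoordN u : ycoord (- u) = - ycoord u.
Proof. by rewrite /ycoord mxE. Qed.

Lemma xcoordZ r u : xcoord (r *: u) = r * xcoord u.
Proof. by rewrite /xcoord mxE. Qed.

Lemma ycoordZ r u : ycoord (r *: u) = r * ycoord u.
Proof. by rewrite /ycoord mxE. Qed.

Lemma xcoord_pt (x y : R) : xcoord (pt x y) = x.
Proof. by rewrite /xcoord mxE eqxx. Qed.

Lemma ycoord_pt (x y : R) : ycoord (pt x y) = y.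
Proof. by rewrite /ycoord mxE. Qed.

Definition coordE :=
  (xcoordD, ycoordD, xcoordN, ycoordN, xcoordZ, ycoordZ, xcoord_pt, ycoord_pt).

Lemma dotE u v : dot u v = xcoord u * xcoord v + ycoord u * ycoord v.
Proof.
rewrite /dot big_ord_recl big_ord1 /xcoord /ycoord.
by rewrite (_ : lift ord0 ord0 = ord_max)//; apply: val_inj.
Qed.

Lemma dotZl r u v : dot (r *: u) v = r * dot u v.
Proof. by rewrite !dotE !coordE; ring. Qed.

Lemma enormE u : enorm u = Num.sqrt (xcoord u ^+ 2 + ycoord u ^+ 2).
Proof. by rewrite /enorm dotE !expr2. Qed.

Lemma enormZ r u : enorm (r *: u) = `|r| * enorm u.
Proof.
rewrite !enormE !coordE !exprMn -mulrDr sqrtrM ?sqr_ge0//.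
by rewrite sqrtr_sqr.
Qed.

Lemma xcoord_le_norm u : `|xcoord u| <= `|u|.
Proof.
rewrite [leRHS]/Num.Def.normr /= mx_normrE; apply/bigmax_geP; right => /=.
by exists (ord0, ord0).
Qed.

Lemma ycoord_le_norm u : `|ycoord u| <= `|u|.
Proof.
rewrite [leRHS]/Num.Def.normr /= mx_normrE; apply/bigmax_geP; right => /=.
by exists (ord0, ord_max).
Qed.

Lemma norm_le_coord u r : `|xcoord u| <= r -> `|ycoord u| <= r -> `|u| <= r.
Proof.
move=> hx hy; have r0 : 0 <= r by exact: le_trans hx.
rewrite [leLHS]/Num.Def.normr /= mx_normrE; apply/bigmax_leP; split => //= -[i j] _ /=.
by rewrite (ord1 i); case: (ord2_cases j) => ->.
Qed.

Lemma norm_le_enorm u : `|u| <= enorm u.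
Proof.
rewrite enormE; apply: norm_le_coord.
- by rewrite -sqrtr_sqr ler_sqrt ?addr_ge0 ?sqr_ge0// lerDl sqr_ge0.
- by rewrite -sqrtr_sqr ler_sqrt ?addr_ge0 ?sqr_ge0// lerDr sqr_ge0.
Qed.

Lemma enorm_le_norm u : enorm u <= 2 * `|u|.
Proof.
rewrite enormE -(@ger0_norm _ (2 * `|u|)) ?mulr_ge0// -sqrtr_sqr.
rewrite ler_sqrt ?sqr_ge0//.
have := xcoord_le_norm u; have := ycoord_le_norm u.
rewrite -(ler_pXn2r (n:=2)) ?nnegrE// => hy.
rewrite -(ler_pXn2r (n:=2)) ?nnegrE// => hx.
rewrite !real_normK ?num_real// in hx hy.
rewrite exprMn; have := sqr_ge0 `|u|; lra.
Qed.

Lemma continuous_xcoord : continuous (@xcoord R).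
Proof. exact: coord_continuous. Qed.

Lemma continuous_ycoord : continuous (@ycoord R).
Proof. exact: coord_continuous. Qed.

Lemma continuous_dotl v : continuous (fun u => dot u v).
Proof.
move=> u; rewrite (_ : (fun u => _) = (fun u : plane R => xcoord u * xcoord v) \+
    (fun u : plane R => ycoord u * ycoord v)); last first.
  by apply/funext => w; rewrite dotE.
apply: (@continuousD _ _ (plane R)).
- by apply: (@continuousM R (plane R) (@xcoord R) (cst (xcoord v)));
    [exact: continuous_xcoord|exact: cst_continuous].
- by apply: (@continuousM R (plane R) (@ycoord R) (cst (ycoord v)));
    [exact: continuous_ycoord|exact: cst_continuous].
Qed.

Lemma continuous_enorm : continuous (@enorm R).
Proof.
rewrite (_ : @enorm R = (fun u => Num.sqrt
    (((@xcoord R) \* (@xcoord R) \+ (@ycoord R) \* (@ycoord R)) u))); last first.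
  by apply/funext => w; rewrite enormE !expr2.
move=> u; apply: (@continuous_comp (plane R)); last exact: sqrt_continuous.
by apply: (@continuousD _ _ (plane R)); apply: (@continuousM R (plane R));
  (exact: continuous_xcoord || exact: continuous_ycoord).
Qed.

Definition closed_cone K := closed K /\ forall r u, K u -> K (r *: u).

Lemma closed_cone_set (K : cone R) : closed_cone (cone_set K).
Proof.
split=> [|r u]; last first.
  rewrite /cone_set /= enormZ dotZl normrM mulrCA => h.
  exact: ler_wpM2l.
rewrite (_ : cone_set K = (fun u => `|dot u (cone_dir K)| - cone_coef K * enorm u)
    @^-1` [set x | 0 <= x]); last first.
  by apply/seteqP; split => u /=; rewrite /cone_set /= subr_ge0.
apply: preimage_closed; last exact: closed_ge.
move=> u _; apply: (@continuousB _ _ (plane R) (fun u => `|dot u (cone_dir K)|)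
    (fun u => cone_coef K * enorm u)).
- apply: (@continuous_comp (plane R) _ _ (fun u => dot u (cone_dir K)) Num.norm).
    exact: continuous_dotl.
  exact: norm_continuous.
- by apply: (@continuousM R (plane R) (cst (cone_coef K)));
    [exact: cst_continuous|exact: continuous_enorm].
Qed.

Lemma cone_set_dir (K : cone R) : cone_set K (cone_dir K).
Proof.
rewrite /cone_set /= cone_dir_unit mulr1.
have h : dot (cone_dir K) (cone_dir K) = 1.
  have := cone_dir_unit K; rewrite /enorm => /(congr1 (fun x => x ^+ 2)).
  rewrite sqr_sqrtr ?expr1n// dotE -!expr2.
  by rewrite addr_ge0 ?sqr_ge0.
by rewrite h normr1 ltW// cone_coef_lt1.
Qed.

Lemma cone_dir_neq0 (K : cone R) : cone_dir K != 0.
Proof.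
apply/eqP => h; have := cone_dir_unit K.
have -> : enorm (cone_dir K) = 0 by rewrite h -(scale0r 0) enormZ normr0 mul0r.
by move/eqP; rewrite eq_sym oner_eq0.
Qed.

(** Two closed cones that meet only in [0] make a positive angle: by compactness
    a unit vector of the first stays at a definite distance from the second.
    With [b] replaced by [- b] this bounds the components of a sum [a + b] by
    the sum itself. *)
Lemma disjoint_cones_bound A B : closed_cone A -> closed_cone B ->
  A `&` B `<=` [set 0] ->
  exists2 k : R, 0 < k & forall a b, A a -> B b -> `|a| <= k * `|a - b|.
Proof.
move=> [cA hA] [cB hB] AB0.
pose S := A `&` [set a | `|a| = 1].
pose T := B `&` [set b | `|b| <= 2].
have cS : compact S.
  apply: bounded_closed_compact.
    by exists 1; split => // x x1 a [_ /= ->]; exact: ltW.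
  apply: closedI => //.
  rewrite (_ : [set a | _] = Num.norm @^-1` [set x : R | x = 1])//.
  by apply: preimage_closed; [move=> ? _; exact: norm_continuous|exact: closed_eq].
have cT : compact T.
  apply: bounded_closed_compact.
    by exists 2; split => // x x1 a [_ /= h]; apply: le_trans h (ltW x1).
  apply: closedI => //.
  rewrite (_ : [set a | _] = Num.norm @^-1` [set x : R | x <= 2])//.
  by apply: preimage_closed; [move=> ? _; exact: norm_continuous|exact: closed_le].
suff [k k0 kP] : exists2 k : R, 0 < k & forall a b, A a -> B b -> `|a| = 1 ->
    k <= `|a - b|.
  exists k^-1; first by rewrite invr_gt0.
  move=> a b Aa Bb; have [->|a0] := eqVneq a 0.
    by rewrite normr0 mulr_ge0// invr_ge0 ltW.
  have na0 : 0 < `|a| by rewrite normr_gt0.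
  have := kP (`|a|^-1 *: a) (`|a|^-1 *: b) (hA _ _ Aa) (hB _ _ Bb).
  rewrite normrZ normfV normr_id mulVf ?gt_eqF// => /(_ erefl).
  rewrite -scalerBr normrZ normfV normr_id => h.
  by rewrite ler_pdivlMl// mulrC -ler_pdivlMl.
(* Vectors [b] of norm greater than 2 are at distance at least 1 from the unit
   sphere, so only the compact set [T] matters. *)
have [[[a0 b0] [/= Sa0 Tb0]]|/set0P/negP] := pselect (S `*` T !=set0); last first.
  rewrite negbK => /eqP ST0; exists 1 => // a b Aa Bb a1.
  have Sa : S a by [].
  have [b2|b2] := leP `|b| 2; last first.
    have := lerB_dist b a; rewrite distrC; lra.
  by suff : set0 (a, b) by []; rewrite -ST0.
have [||[a b]] := @compact_EVT_min _ R
  (fun ab : plane R * plane R => `|ab.1 - ab.2|) (S `*` T) _ (compact_setX cS cT).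
- by exists (a0, b0).
- apply: continuous_subspaceT => -[a b] /=.
  apply: (@continuous_comp _ _ _ (fun ab : plane R * plane R => ab.1 - ab.2) Num.norm);
    last exact: norm_continuous.
  by apply: cvgB; [exact: cvg_fst|exact: cvg_snd].
rewrite inE => -[/= [Aa a1] [Bb b2]] abmin.
have ab0 : 0 < `|a - b|.
  rewrite normr_gt0 subr_eq0; apply/eqP => ab.
  have /AB0 /= a_0 : (A `&` B) a by split => //; rewrite ab.
  by move: a1 => /=; rewrite a_0 normr0 => /eqP; rewrite eq_sym oner_eq0.
exists (Num.min 1 `|a - b|); first by rewrite lt_min ltr01.
move=> a' b' Aa' Bb' a1'; rewrite ge_min.
have [b2'|b2'] := leP `|b'| 2; last first.
  have := lerB_dist b' a'; rewrite distrC => h.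
  by apply/orP; left; lra.
by apply/orP; right; apply: (abmin (a', b')); rewrite inE.
Qed.

Lemma span2 u v e : xcoord u * ycoord v - ycoord u * xcoord v != 0 ->
  exists r s : R, e = r *: u - s *: v.
Proof.
set d := (X in X != 0) => d0.
exists ((xcoord e * ycoord v - ycoord e * xcoord v) / d).
exists (- (xcoord u * ycoord e - ycoord u * xcoord e) / d).
by apply: planeP; rewrite !coordE; move: d0; rewrite /d => d0; field.
Qed.

Lemma collinear u v : v != 0 -> xcoord u * ycoord v - ycoord u * xcoord v = 0 ->
  exists r : R, u = r *: v.
Proof.
move=> v0 h; have [x0|x0] := eqVneq (xcoord v) 0.
  have y0 : ycoord v != 0.
    by apply: contra_neq v0 => y0; apply: planeP; rewrite ?x0 ?y0 /xcoord /ycoord mxE.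
  exists (ycoord u / ycoord v).
  move: h; rewrite x0 mulr0 subr0 => /eqP; rewrite mulf_eq0 (negbTE y0) orbF => /eqP ux.
  apply: planeP; rewrite !coordE ?x0 ?ux ?mulr0// divfK//.
exists (xcoord u / xcoord v).
apply: planeP; rewrite !coordE ?divfK//.
apply: (mulIf x0); rewrite mulrAC divfK//.
by apply/esym/eqP; rewrite -subr_eq0 h.
Qed.

End PlaneGeometry.

(** * Curves and their chords *)

Section Curves.
Variable R : realType.
Implicit Types (P Q u v : plane R) (K A B : set (plane R)).

Lemma is_derive_comp_diff (V W : normedModType R) (f : V -> W) (c : R -> V)
    (t : R) (v : V) : differentiable f (c t) -> is_derive t 1 c v ->
  is_derive t 1 (f \o c) ('d f (c t) v).
Proof.
move=> df dc; have cd : differentiable c t.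
  by apply/derivable1_diffP; exact: (ex_derive (is_derive := dc)).
have dfc := differentiable_comp cd df.
split; first exact/derivable1_diffP.
rewrite deriveE// diff_comp//=; congr ('d f (c t) _).
by rewrite -deriveE//; exact: (derive_val (is_derive := dc)).
Qed.

Lemma is_derive_line (V : normedModType R) (P w : V) :
  is_derive (0 : R) 1 (fun s : R => P + s *: w) w.
Proof.
have d : is_derive (0 : R) 1 (fun s : R => s *: w) w.
  have ds : is_diff (0 : R) ( *:%R^~ w : R -> V) ( *:%R^~ w).
    exact: is_diff_scalel.
  have df := @ex_diff _ _ _ _ _ _ _ ds.
  split; first exact/derivable1_diffP.
  by rewrite deriveE// diff_val scale1r.
by have := is_deriveD (is_derive_cst P (0 : R) 1) d; rewrite add0r.
Qed.

Lemma is_derive_xcoord (c : R -> plane R) (t : R) v :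
  is_derive t 1 c v -> is_derive t 1 (fun s => xcoord (c s)) (xcoord v).
Proof.
move=> dc; have h := ex_derive (is_derive := dc).
split; first by move/derivable_mxP : (h); exact.
by rewrite -(derive_val (is_derive := dc)) derive_mx// /xcoord mxE.
Qed.

Lemma is_derive_ycoord (c : R -> plane R) (t : R) v :
  is_derive t 1 c v -> is_derive t 1 (fun s => ycoord (c s)) (ycoord v).
Proof.
move=> dc; have h := ex_derive (is_derive := dc).
split; first by move/derivable_mxP : (h); exact.
by rewrite -(derive_val (is_derive := dc)) derive_mx// /ycoord mxE.
Qed.

(** Rolle's theorem for the area form [h s] spanned by the chord and [c s], which
    takes the same value at both ends of the chord. *)
Lemma chord_parallel_tangent (c c' : R -> plane R) (a b : R) : a < b ->
  (forall t : R, is_derive t 1 c (c' t)) -> (forall t, c' t != 0) ->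
  exists t r, c b - c a = r *: c' t.
Proof.
move=> ab dc c'0; set d := c b - c a.
pose h s := xcoord d * ycoord (c s) - ycoord d * xcoord (c s).
have dh (s : R) : is_derive s 1 h (xcoord d * ycoord (c' s) - ycoord d * xcoord (c' s)).
  have := is_derive_xcoord (dc s); have := is_derive_ycoord (dc s) => dy dx.
  exact: is_deriveB.
have [|||t _ [_ ht]] := @Rolle R h a b ab.
- by move=> x _; exact: (ex_derive (is_derive := dh x)).
- apply: derivable_within_continuous => x _.
  exact: (ex_derive (is_derive := dh x)).
- by rewrite /h /d !coordE; ring.
exists t; apply: collinear => //.
by rewrite -ht; apply/esym; exact: (derive_val (is_derive := dh t)).
Qed.

Lemma chord_in_cone (c c' : R -> plane R) K (a b : R) : closed_cone K ->
  (forall t : R, is_derive t 1 c (c' t)) -> (forall t, c' t != 0) ->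
  (forall t, K (c' t)) -> K (c a - c b).
Proof.
move=> [_ KZ] dc c'0 Kc'; case: (ltgtP a b) => [ab|ba|->].
- have [t [r e]] := chord_parallel_tangent ab dc c'0.
  by rewrite -opprB -scaleN1r e scalerA; exact: KZ.
- by have [t [r ->]] := chord_parallel_tangent ba dc c'0; exact: KZ.
- by rewrite subrr -(scale0r (c' 0)); exact: KZ.
Qed.

(** * Intersecting the image of a map with a transverse curve *)

Definition proper_curve (c : R -> plane R) :=
  forall M : R, exists N : R, forall t, `|c t| <= M -> `|t| <= N.

Lemma compact_norm_ball P (r : R) : compact [set Q : plane R | `|Q - P| <= r].
Proof.
apply: bounded_closed_compact.
  exists (`|P| + r); split; first by rewrite num_real.
  move=> x hx Q /= hQ; apply: le_trans (ltW hx).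
  by rewrite -(subrK P Q) addrC (le_trans (ler_normD _ _))// lerD2l.
rewrite (_ : [set Q | _] = (fun Q => `|Q - P|) @^-1` [set x : R | x <= r])//.
apply: preimage_closed; last exact: closed_le.
move=> Q _; apply: (@continuous_comp (plane R) _ _ (fun Q => Q - P) Num.norm).
  by apply: (@continuousB _ _ (plane R)); [exact: cvg_id|exact: cst_continuous].
exact: norm_continuous.
Qed.


(** A path that starts at [- e] with velocity [e] heads straight for the origin,
    so its norm decreases at rate [|e|]. *)
Lemma first_order_decrease (h : R -> plane R) e (eps : R) : h 0 = - e ->
  is_derive (0 : R) 1 h e -> 0 < eps ->
  exists2 d : R, 0 < d &
    forall s, 0 < s -> s < d -> `|h s| <= (1 - s) * `|e| + s * eps.
Proof.
move=> h0 [dh he] eps0.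
have /cvgrPdist_le /(_ _ eps0) [d /= d0 hd] :
    (fun s : R => s^-1 *: (h (s *: 1 + 0) - h 0)) @ 0^' --> e.
  by rewrite -he; exact: dh.
exists (Num.min 1 d); first by rewrite lt_min ltr01.
move=> s s0; rewrite lt_min => /andP[s1 sd].
have := hd s; rewrite /ball_ /= sub0r normrN gtr0_norm// => /(_ sd).
rewrite gt_eqF// => /(_ isT); rewrite addr0 [s *: 1](mulr1) => hs.
have -> : h s = - ((1 - s) *: e + s *: (e - s^-1 *: (h s - h 0))).
  rewrite h0 (scalerBr s) scalerA mulfV ?gt_eqF// scale1r scalerBl scale1r.
  by rewrite subrKA opprK opprB addrK.
rewrite normrN (le_trans (ler_normD _ _))// !normrZ.
rewrite (ger0_norm (_ : 0 <= 1 - s)) ?subr_ge0 ?(ltW s1)// (gtr0_norm s0).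
by rewrite lerD2l ler_wpM2l// ltW.
Qed.

Lemma is_derive_line_comp (V W : normedModType R) (f : V -> W) (P w : V) :
  differentiable f P -> is_derive (0 : R) 1 (fun s : R => f (P + s *: w)) ('d f P w).
Proof.
move=> df; have dl := is_derive_line P w.
have := is_derive_comp_diff (f := f) _ dl.
by rewrite scale0r addr0 => /(_ df).
Qed.

Lemma is_derive_reparam (c : R -> plane R) (t b : R) v :
  is_derive t 1 c v -> is_derive (0 : R) 1 (fun s : R => c (t + s * b)) (b *: v).
Proof.
move=> dc; have cd : differentiable c t.
  by apply/derivable1_diffP; exact: (ex_derive (is_derive := dc)).
have -> : b *: v = 'd c t b.
  by rewrite diff1E//= derive1E (derive_val (is_derive := dc)).
exact: (is_derive_line_comp (V := R)).
Qed.

(** If, everywhere, each displacement [e] of [f P - c t] can be produced to first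
    order by moving [P] by at most [k * |e|] and moving [t] freely, then [f] takes
    a value on the curve at a distance from [P0] controlled by the gap
    [|f P0 - c 0|].  The minimum of [J] is the point sought: at a minimum with a
    nonzero gap [e], closing the gap at unit speed gains [|e|] in the first term of
    [J] and costs at most half of that in the second.  Properness of the curve
    makes the minimisation a compact problem. *)
Lemma transverse_intersection (f : plane R -> plane R) (c c' : R -> plane R)
    (k : R) P0 :
  (forall P, differentiable f P) -> (forall t : R, is_derive t 1 c (c' t)) ->
  proper_curve c -> 0 < k ->
  (forall P t e, exists w b, e = 'd f P w - b *: c' t /\ `|w| <= k * `|e|) ->
  exists P t, f P = c t /\ `|P - P0| <= 2 * k * `|f P0 - c 0|.
Proof.
move=> df dc pc k0 surj.
have cf : continuous f by move=> P; exact: differentiable_continuous.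
have cc : continuous c.
  move=> t; apply/differentiable_continuous/derivable1_diffP.
  exact: (ex_derive (is_derive := dc t)).
set E := `|f P0 - c 0|.
have E0 : 0 <= E by exact: normr_ge0.
pose C1 := [set Q : plane R | `|Q - P0| <= 2 * k * E + 1].
have [M fM] : exists M, forall Q, C1 Q -> `|f Q| <= M.
  have [M [_ hM]] : bounded_set (f @` C1).
    apply: compact_bounded; apply: continuous_compact; last exact: compact_norm_ball.
    exact: continuous_subspaceT.
  exists (M + 1) => Q CQ; apply: hM; last by exists Q.
  by rewrite ltrDl.
(* The margins [+ 1] in [C1] and [C2] make the minimum an interior point. *)
have [N hN] := pc (E + M).
pose C2 := `[- (N + 1), N + 1]%classic : set R.
pose J (x : plane R * R) := `|f x.1 - c x.2| + (2 * k)^-1 * `|x.1 - P0|.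
have cJ : continuous J.
  move=> x; apply: (@continuousD _ _ (plane R * R)%type
    (fun x => `|f x.1 - c x.2|) (fun x => (2 * k)^-1 * `|x.1 - P0|)).
    apply: (@continuous_comp _ _ _ (fun x : plane R * R => f x.1 - c x.2) Num.norm);
      last exact: norm_continuous.
    apply: (@continuousB _ _ _ (fun x : plane R * R => f x.1)
      (fun x : plane R * R => c x.2)).
    - by apply: (@continuous_comp _ _ _ fst f); [exact: cvg_fst|exact: cf].
    - by apply: (@continuous_comp _ _ _ snd c); [exact: cvg_snd|exact: cc].
  apply: (@continuousM _ _ (cst (2 * k)^-1) (fun x : plane R * R => `|x.1 - P0|)).
    exact: cst_continuous.
  apply: (@continuous_comp _ _ _ (fun x : plane R * R => x.1 - P0) Num.norm);
      last exact: norm_continuous.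
  apply: (@continuousB _ _ _ (fun x : plane R * R => x.1) (cst P0)).
  - exact: cvg_fst.
  - exact: cst_continuous.
have J0 : J (P0, 0) = E by rewrite /J /= subrr normr0 mulr0 addr0.
have N0 : 0 <= N.
  have : C1 P0 by rewrite /C1 /= subrr normr0 addr_ge0// !mulr_ge0// ltW.
  move=> /fM fP0; have := hN 0; suff h : `|c 0| <= E + M by move=> /(_ h); rewrite normr0.
  have -> : c 0 = - (f P0 - c 0) + f P0 by rewrite opprB subrK.
  by rewrite (le_trans (ler_normD _ _))// normrN lerD2l.
have cC : compact (C1 `*` C2).
  by apply: compact_setX; [exact: compact_norm_ball|exact: segment_compact].
have C00 : (C1 `*` C2) (P0, 0).
  split; rewrite /C1 /C2 /=.
    by rewrite subrr normr0 addr_ge0// !mulr_ge0// ltW.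
  by rewrite in_itv /=; apply/andP; split; lra.
have [|[P t]] := compact_EVT_min _ cC (continuous_subspaceT cJ).
- by exists (P0, 0).
rewrite inE => -[/= CP Ct] Jmin.
have JE : J (P, t) <= E.
  by rewrite -J0; apply: Jmin; rewrite inE.
have k20 : 0 < 2 * k by rewrite mulr_gt0.
have PE : `|P - P0| <= 2 * k * E.
  rewrite -ler_pdivrMl//; apply: le_trans JE; rewrite /J /= lerDr//.
have tN : `|t| <= N.
  apply: hN; have -> : c t = - (f P - c t) + f P by rewrite opprB subrK.
  rewrite (le_trans (ler_normD _ _))// normrN lerD//; last exact: fM.
  apply: le_trans JE; rewrite /J /= lerDl// mulr_ge0// invr_ge0 ltW//.
exists P, t; split => //; apply/eqP; rewrite -subr_eq0 -oppr_eq0 opprB; apply/eqP.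
set e := c t - f P; have [//|e0] := eqVneq e 0; exfalso.
have ne0 : 0 < `|e| by rewrite normr_gt0.
have [w [b [ewb wk]]] := surj P t e.
pose h s := f (P + s *: w) - c (t + s * b).
have dh : is_derive (0 : R) 1 h e.
  rewrite ewb; apply: is_deriveB.
  - exact: is_derive_line_comp.
  - exact: is_derive_reparam.
have h0 : h 0 = - e by rewrite /h scale0r mul0r !addr0 opprB.
(* The error [s * |e| / 4] is small against the net gain [s * |e| / 2]. *)
have [d d0 hd] := first_order_decrease h0 dh (divr_gt0 ne0 (ltr0n _ 4)).
have [s [s0 sd sw sb]] : exists s, [/\ 0 < s, s < d, s * `|w| <= 1 & s * `|b| <= 1].
  exists (Num.min (d / 2) (Num.min (`|w| + 1)^-1 (`|b| + 1)^-1)).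
  have w0 : 0 < `|w| + 1 by rewrite ltr_wpDl.
  have b0 : 0 < `|b| + 1 by rewrite ltr_wpDl.
  split.
  - by rewrite !lt_min !invr_gt0 w0 b0 divr_gt0.
  - by rewrite gt_min; apply/orP; left; lra.
  - apply: (@le_trans _ _ ((`|w| + 1)^-1 * `|w|)).
      by rewrite ler_wpM2r// !ge_min lexx /= orbT.
    by rewrite ler_pdivrMl// mulr1 lerDl.
  - apply: (@le_trans _ _ ((`|b| + 1)^-1 * `|b|)).
      by rewrite ler_wpM2r// !ge_min lexx /= !orbT.
    by rewrite ler_pdivrMl// mulr1 lerDl.
have : (P + s *: w, t + s * b) \in C1 `*` C2.
  rewrite inE; split; rewrite /C1 /C2 /=.
    rewrite addrAC (le_trans (ler_normD _ _))// normrZ (gtr0_norm s0).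
    by rewrite lerD.
  rewrite in_itv /= -ler_norml (le_trans (ler_normD _ _))//.
  by rewrite lerD// normrM (gtr0_norm s0).
move/Jmin; rewrite leNgt => /negP; apply; rewrite /J /= -/(h s).
have ePc : `|f P - c t| = `|e| by rewrite distrC.
have h1 := hd s s0 sd.
have h2 : `|P + s *: w - P0| <= `|P - P0| + s * (k * `|e|).
  rewrite addrAC (le_trans (ler_normD _ _))// lerD2l normrZ (gtr0_norm s0).
  by rewrite ler_pM2l.
have h3 : (2 * k)^-1 * `|P + s *: w - P0| <= (2 * k)^-1 * `|P - P0| + s * `|e| / 2.
  apply: le_trans (_ : (2 * k)^-1 * (`|P - P0| + s * (k * `|e|)) <= _).
    by rewrite ler_pM2l// invr_gt0.
  rewrite mulrDr lerD2l le_eqVlt; apply/orP; left; apply/eqP; field.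
  exact: lt0r_neq0.
have h4 : 0 < s * `|e| by rewrite mulr_gt0.
rewrite ePc; lra.
Qed.

End Curves.

(** * Bounded orbits of sequences of hyperbolic maps *)

Section HyperbolicSequences.
Variable R : realType.
Implicit Types (P Q u v : plane R) (K : set (plane R)).
Implicit Types (A B : plane R -> set (plane R)) (f g : plane R -> plane R).

Definition expands A (mu : R) f := forall P, differentiable f P /\
  forall u, A P u -> A (f P) ('d f P u) /\ mu * enorm u <= enorm ('d f P u).

(** The inverse [g] is part of the data so that the notion is symmetric under
    exchanging the two cone fields and inverting the map ([hyperbolic_sym]). *)
Definition hyperbolic A B (mu : R) f g :=
  [/\ cancel f g, cancel g f, expands A mu f & expands B mu g].

Lemma enorm_gt0 u : u != 0 -> 0 < enorm u.
Proof. by rewrite -normr_gt0 => /lt_le_trans; apply; exact: norm_le_enorm. Qed.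

Lemma expands_neq0 A mu f P u : 0 < mu -> expands A mu f -> A P u -> u != 0 ->
  'd f P u != 0.
Proof.
move=> mu0 /(_ P)[_ h] /h[_ hu] /enorm_gt0 u0; apply/eqP => fu0.
have : 0 < mu * enorm u by rewrite mulr_gt0.
rewrite ltNge (le_trans hu)// fu0 -(scale0r 0) enormZ normr0 mul0r//.
Qed.

Lemma expands_id A : expands A 1 id.
Proof.
move=> P; split; first exact: (@ex_diff _ _ _ _ _ _ _ (is_diff_id P)).
by move=> u Au; rewrite (@diff_val _ _ _ _ _ _ _ (is_diff_id P)) mul1r.
Qed.

Lemma expands_comp A (mu nu : R) f f' : 0 <= nu ->
  expands A mu f -> expands A nu f' -> expands A (nu * mu) (f' \o f).
Proof.
move=> nu0 hf hf' P; have [df Af] := hf P; have [df' Af'] := hf' (f P).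
split; first exact: differentiable_comp.
move=> u Au; rewrite diff_comp//=; have [Au1 hu1] := Af u Au.
have [Au2 hu2] := Af' _ Au1; split => //.
by rewrite -mulrA (le_trans _ hu2)// ler_wpM2l.
Qed.

Lemma hyperbolic_comp A B (mu nu : R) f g f' g' : 0 <= mu -> 0 <= nu ->
  hyperbolic A B mu f g -> hyperbolic A B nu f' g' ->
  hyperbolic A B (nu * mu) (f' \o f) (g \o g').
Proof.
move=> mu0 nu0 [fK gK ef eg] [f'K g'K ef' eg']; split.
- exact: can_comp.
- exact: can_comp.
- exact: expands_comp.
- by rewrite mulrC; exact: expands_comp.
Qed.

Lemma hyperbolic_sym A B (mu : R) f g : hyperbolic A B mu f g ->
  hyperbolic B A mu g f.
Proof. by case. Qed.

Lemma closed_approx K P : closed K ->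
  (forall eps : R, 0 < eps -> exists2 Q, K Q & `|Q - P| < eps) -> K P.
Proof.
move=> cK h; apply: contrapT => nKP.
have /nbhs_ballP[e /= e0 he] : nbhs P (~` K).
  by apply: open_nbhs_nbhs; split => //; exact: closed_openC.
have [Q KQ Qe] := h _ e0; apply: (he Q) => //.
by rewrite -ball_normE /= distrC.
Qed.

Section BoundedOrbits.
Variables (A B : plane R -> set (plane R)) (KA KB : set (plane R)).
Variables (c c' : R -> plane R).
Hypothesis KAcone : closed_cone KA.
Hypothesis KBcone : closed_cone KB.
Hypothesis disjK : KA `&` KB `<=` [set 0].
Hypothesis AK : forall P, A P `<=` KA.
Hypothesis BK : forall P, B P `<=` KB.
Hypothesis Anz : forall P, exists2 u, A P u & u != 0.
Hypothesis dc : forall t : R, is_derive t 1 c (c' t).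
Hypothesis c'0 : forall t, c' t != 0.
Hypothesis c'B : forall t, B (c t) (c' t).
Hypothesis pc : proper_curve c.

(** An expanding [f] sends [A]-vectors into [KA], transverse to the tangents of
    [c].  So any [e] splits into the image of an [A]-vector and a tangent of [c],
    the former of size [O(|e|)] by the angle bound; its preimage has size
    [O(|e| / mu)]. *)
Lemma near_pulled_back_curve : exists2 k : R, 0 < k &
  forall mu f P, 0 < mu -> expands A mu f ->
  exists Q t, f Q = c t /\ `|Q - P| <= k / mu * `|f P - c 0|.
Proof.
have [k k0 kP] := disjoint_cones_bound KAcone KBcone disjK.
exists (2 * (2 * k)); first by rewrite !mulr_gt0.
move=> mu f P mu0 ef.
have k20 : 0 < 2 * k / mu by rewrite divr_gt0// mulr_gt0.
have := transverse_intersection (f := f) P (fun P => (ef P).1) dc pc k20.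
rewrite !mulrA; apply => {}P t e.
have [u Au u0] := Anz P; have [Au1 hu1] := (ef P).2 u Au.
have fu0 := expands_neq0 mu0 ef Au u0.
have KAfu := AK Au1; have KBc := BK (c'B t).
have det0 : xcoord ('d f P u) * ycoord (c' t) - ycoord ('d f P u) * xcoord (c' t) != 0.
  apply/eqP => /(collinear (c'0 t))[r fur].
  have /disjK /= : (KA `&` KB) ('d f P u).
    by split => //; rewrite fur; exact: (KBcone.2).
  exact/eqP.
have [r [s ers]] := span2 e det0.
exists (r *: u), s; split; first by rewrite linearZ.
rewrite (le_trans (norm_le_enorm _))// mulrAC ler_pdivlMr// mulrC.
apply: (@le_trans _ _ (enorm (r *: 'd f P u))).
  by rewrite !enormZ mulrCA ler_wpM2l.
rewrite (le_trans (enorm_le_norm _))// -mulrA ler_pM2l// ers.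
by apply: kP; [exact: (KAcone.2)|exact: (KBcone.2)].
Qed.

(** The composite [f] of the first [n] maps brings both points to distance at most
    [M + |c 0|] from [c 0], so they lie within [O(lambda ^- n)] of the preimage of
    [c], all of whose chords are in [KB]. *)
Lemma bounded_orbits_chord (lambda : R) (X Y : nat -> plane R) (M : R) :
  1 < lambda -> (forall n, `|X n| <= M) -> (forall n, `|Y n| <= M) ->
  (forall n, exists f g,
    [/\ hyperbolic A B lambda f g, f (X n) = X n.+1 & f (Y n) = Y n.+1]) ->
  KB (X 0%N - Y 0%N).
Proof.
move=> l1 XM YM step.
have l0 : 0 < lambda by exact: lt_trans l1.
have iterate n : exists f g,
    [/\ hyperbolic A B (lambda ^+ n) f g, f (X 0%N) = X n & f (Y 0%N) = Y n].
  elim: n => [|n [f [g [hfg fX fY]]]].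
    by exists id, id; split => //; split => //; rewrite expr0; exact: expands_id.
  have [f' [g' [hfg' fX' fY']]] := step n.
  exists (f' \o f), (g \o g'); split; last 2 first.
  - by rewrite -fX' -fX.
  - by rewrite -fY' -fY.
  rewrite exprS; apply: hyperbolic_comp hfg hfg'; last exact: ltW.
  exact/exprn_ge0/ltW.
have [k k0 kP] := near_pulled_back_curve.
apply: closed_approx; first exact: KBcone.1.
move=> eps eps0.
pose D := k * (M + `|c 0|).
have D0 : 0 <= D 
  by apply: mulr_ge0; [exact: ltW|rewrite addr_ge0// (le_trans _ (XM 0%N))].
have [n nD] : exists n, D / lambda ^+ n < eps / 2.
  have : (D * lambda^-1 ^+ n) @[n --> \oo] --> (0 : R).
    rewrite -(mulr0 D); apply: cvgM; first exact: cvg_cst.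
    by apply: cvg_expr; rewrite ger0_norm ?invr_ge0 ?ltW// invf_lt1.
  move/cvgrPdist_lt => /(_ (eps / 2) (divr_gt0 eps0 (ltr0n _ 2))) [n _ /(_ n (leqnn _))].
  rewrite sub0r normrN => h; exists n; rewrite -exprVn.
  exact: le_lt_trans (ler_norm _) h.
have [f [g [[fK gK ef eg] fX fY]]] := iterate n.
have mu0 : 0 < lambda ^+ n by rewrite exprn_gt0.
have near Z : `|f Z| <= M -> exists Q t, f Q = c t /\ `|Q - Z| < eps / 2.
  move=> fZM; have [Q [t [fQ hQ]]] := kP _ _ Z mu0 ef.
  exists Q, t; split => //; apply: le_lt_trans nD.
  apply: le_trans hQ _; rewrite /D [leRHS]mulrAC.
  rewrite ler_pM2l ?divr_gt0// (le_trans (ler_normB _ _))// lerD2r//.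
have [|P [a [Pa hP]]] := near (X 0%N); first by rewrite fX.
have [|Q [b [Qb hQ]]] := near (Y 0%N); first by rewrite fY.
exists (P - Q).
  rewrite -(fK P) -(fK Q) Pa Qb.
  apply: (@chord_in_cone _ (g \o c) (fun t => 'd g (c t) (c' t))) => //.
  - by move=> t; apply: is_derive_comp_diff => //; exact: (eg _).1.
  - by move=> t; exact: (expands_neq0 mu0 eg (c'B t)).
  - by move=> t; apply: (BK (P := g (c t))); exact: ((eg _).2 _ (c'B t)).1.
rewrite (_ : P - Q - _ = (P - X 0%N) - (Q - Y 0%N)); last first.
  by rewrite !opprB addrACA [RHS]addrACA; congr (_ + _); rewrite addrC.
by rewrite (le_lt_trans (ler_normB _ _))// (splitr eps) ltrD.
Qed.

End BoundedOrbits.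

End HyperbolicSequences.

(** * Lozi-like maps *)

Section LoziLike.
Variable R : realType.
Implicit Types (P Q u v : plane R) (G D : set (plane R)).

Lemma is_derive_pt (a b : R -> R) (t a' b' : R) :
  is_derive t 1 a a' -> is_derive t 1 b b' ->
  is_derive t 1 (fun s => pt (a s) (b s)) (pt a' b').
Proof.
move=> da db.
have ha : (fun s => pt (a s) (b s) ord0 ord0) = a.
  by apply/funext => s; rewrite mxE eqxx.
have hb : (fun s => pt (a s) (b s) ord0 ord_max) = b.
  by apply/funext => s; rewrite mxE.
have d : derivable (fun s => pt (a s) (b s)) t 1.
  apply/derivable_mxP => i j; rewrite (ord1 i).
  case: (ord2_cases j) => ->; rewrite ?ha ?hb.
  - exact: (ex_derive (is_derive := da)).
  - exact: (ex_derive (is_derive := db)).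
split => //; rewrite derive_mx//; apply/rowP => j; rewrite [LHS]mxE.
case: (ord2_cases j) => ->; rewrite ?ha ?hb mxE ?eqxx /=.
- exact: (derive_val (is_derive := da)).
- exact: (derive_val (is_derive := db)).
Qed.

Lemma tangent_vector_curve G (c : R -> plane R) (t : R) v :
  (forall s, G (c s)) -> is_derive t 1 c v -> tangent_vector G (c t) v.
Proof.
move=> Gc dc; exists (fun s => c (t + s * 1)); split.
- by rewrite mul0r addr0.
- by near=> s; exact: Gc.
- by have := is_derive_reparam 1 dc; rewrite scale1r.
Unshelve. all: by end_near.
Qed.

Lemma proper_comp (f g : plane R -> plane R) (c : R -> plane R) :
  cancel f g -> continuous g -> proper_curve c -> proper_curve (f \o c).
Proof.
move=> fK cg pc M.
have [N [_ hN]] : bounded_set (g @` [set Q | `|Q - 0| <= M]).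
  apply: compact_bounded; apply: continuous_compact; last exact: compact_norm_ball.
  exact: continuous_subspaceT.
have [N' hN'] := pc (N + 1); exists N' => t /= ft; apply: hN'.
apply: (hN (N + 1)); first by rewrite ltrDl.
by exists (f (c t)); rewrite ?fK//= subr0.
Qed.

Lemma graph_proper (a : R -> R) : proper_curve (fun t => pt (a t) t).
Proof.
move=> M; exists M => t; apply: le_trans.
by have := ycoord_le_norm (pt (a t) t); rewrite ycoord_pt.
Qed.

Lemma closed_disk_compact : compact (@closed_disk R).
Proof.
apply: bounded_closed_compact.
  exists 1; split; first exact: num_real.
  move=> x x1 P /= hP; rewrite (le_trans (norm_le_enorm _))//.
  exact: le_trans hP (ltW x1).
rewrite (_ : @closed_disk R = @enorm R @^-1` [set x : R | x <= 1])//.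
by apply: preimage_closed; [move=> ? _; exact: continuous_enorm|exact: closed_le].
Qed.

Lemma disk_closure_bounded D : homeomorphic (closure D) (@closed_disk R) ->
  exists M, forall P, D P -> `|P| <= M.
Proof.
move=> [f [g [_ cg fP gP]]].
have : bounded_set (g @` (@closed_disk R)).
  by apply: compact_bounded; apply: continuous_compact => //; exact: closed_disk_compact.
move=> [M [_ hM]]; exists (M + 1) => P /subset_closure /fP[fPd gfP].
by apply: hM; [rewrite ltrDl|exists (f P)].
Qed.

Lemma diff_cancel (f g : plane R -> plane R) P u : cancel f g ->
  differentiable f P -> differentiable g (f P) -> 'd g (f P) ('d f P u) = u.
Proof.
move=> fK df dg.
have gf : 'd (g \o f) P u = 'd g (f P) ('d f P u).
  exact: (congr1 (fun h : plane R -> plane R => h u) (diff_comp df dg)).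
have gfid : g \o f = id by exact/funext.
have idE : 'd (@id (plane R)) P u = u.
  exact: (congr1 (fun h : plane R -> plane R => h u)
    (@diff_val _ _ _ _ _ _ _ (is_diff_id P))).
by transitivity ('d (g \o f) P u); [symmetry|rewrite gfid; exact: idE].
Qed.

Lemma diff_neq0 (f g : plane R -> plane R) P u : cancel f g ->
  differentiable f P -> differentiable g (f P) -> u != 0 -> 'd f P u != 0.
Proof.
move=> fK df dg; apply: contra_neq => du0.
have guE := diff_cancel u fK df dg.
apply: etrans (esym guE) _.
by apply: etrans (congr1 ('d g (f P)) du0) _; exact: linear0.
Qed.

Lemma diffeo_hyperbolic (F : C1_diffeo R) (lambda : R) Ku Ks KuP KsP :
  cone_invariance F Ku Ks KuP KsP -> cone_expansion F lambda KuP KsP ->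
  hyperbolic (fun P => cone_set (KuP P)) (fun P => cone_set (KsP P)) lambda
    F (diffeo_inv F).
Proof.
move=> inv exp; split; [exact: diffeo_mapK|exact: diffeo_invK|..] => P.
- split; first exact: (diffeo_map_C1 F).1.
  move=> u Ku_u; have [_ _ h _] := inv P; have [hu _] := exp P.
  by split; [apply: h; exists u|exact: hu].
- split; first exact: (diffeo_inv_C1 F).1.
  move=> w Ks_w; have [_ _ _ h] := inv P; have [_ hw] := exp P.
  by split; [apply: h; exists w|exact: hw].
Qed.

Lemma left_or_right (a : R -> R) P :
  let G := [set pt (a y) y | y in [set: R]] in left_half G P \/ right_half G P.
Proof.
move=> G; have Gq : G (pt (a (ycoord P)) (ycoord P)) by exists (ycoord P).
by case: (leP (xcoord P) (a (ycoord P))) => [h|/ltW h]; [left|right];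
  exists (pt (a (ycoord P)) (ycoord P)); rewrite ycoord_pt xcoord_pt.
Qed.

(** [G] meets the vertical line through [P] only once, so the point above [P] and
    the point below it coincide and squeeze [P]. *)
Lemma lower_upper G P :
  {in G &, forall Q Q', xcoord Q = xcoord Q' -> Q = Q'} ->
  lower_half G P -> upper_half G P -> G P.
Proof.
move=> Ginj [Q [GQ Qx Qy]] [Q' [GQ' Qx' Qy']].
have QQ' : Q = Q' by apply: Ginj; rewrite ?inE// Qx Qx'.
suff -> : P = Q by [].
apply: planeP => //; apply/le_anti; rewrite Qy /= QQ'//.
Qed.

(** Points on opposite sides of the divider can have equal images only on the
    image of the divider, where [F1] and [F2] agree. *)
Lemma pasted_map_inj (F1 F2 : C1_diffeo R) (a : R -> R) F :
  let G := [set pt (a y) y | y in [set: R]] in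
  half_plane_convention F1 F2 G -> pasted_map F1 F2 G F ->
  (forall P, G P -> F1 P = F2 P) ->
  {in F1 @` G &, forall Q Q', xcoord Q = xcoord Q' -> Q = Q'} ->
  injective F.
Proof.
move=> G [hl hr _ hr2] [Fl Fr] F12 Ginj.
have imG : F2 @` G = F1 @` G.
  by apply/seteqP; split => _ [P GP <-]; exists P => //; rewrite F12.
have inj1 := can_inj (@diffeo_mapK _ F1); have inj2 := can_inj (@diffeo_mapK _ F2).
have cross P Q : left_half G P -> right_half G Q -> F P = F Q -> P = Q.
  move=> lP rQ; rewrite Fl// Fr// => e.
  have GF : (F1 @` G) (F1 P).
    apply: lower_upper => //; first by rewrite -hl; exists P.
    by rewrite e -imG -hr2; exists Q.
  have [P' GP' /inj1 eP] := GF; rewrite eP in GP'.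
  by apply: inj2; rewrite -e F12.
move=> P Q e; case: (left_or_right a P) (left_or_right a Q) => hP [] hQ.
- by apply: inj1; rewrite -!Fl.
- exact: cross.
- by apply/esym/cross.
- by apply: inj2; rewrite -!Fr.
Qed.

Lemma iter_shift (F : plane R -> plane R) n k P : (k <= n)%N -> injective F ->
  iter k (pinv setT F) (iter n F P) = iter (n - k) F P.
Proof.
move=> kn injF; elim: k kn => [|k IH] kn; first by rewrite subn0.
rewrite iterS (IH (ltnW kn)) -(subnSK kn) iterS.
by rewrite pinvKV ?inE// => x y _ _; exact: injF.
Qed.

Lemma same_branch (F1 F2 : C1_diffeo R) G F p P Q (n : int) :
  pasted_map F1 F2 G F -> itinerary F G p P -> itinerary F G p Q ->
  exists F0, [/\ F0 = F1 \/ F0 = F2, F (ziter F n P) = F0 (ziter F n P) &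
    F (ziter F n Q) = F0 (ziter F n Q)].
Proof.
move=> [Fl Fr] iP iQ; have := iP n; have := iQ n; case: (p n) => hQ hP.
- by exists F1; split; [left|exact: Fl|exact: Fl].
- by exists F2; split; [right|exact: Fr|exact: Fr].
Qed.

End LoziLike.

Theorem lemma4p1 (R : realType) (F1 F2 : C1_diffeo R)
    (Gamma : set (plane R)) (F : plane R -> plane R) (Lambda : set (plane R))
    (hF : lozi_like F1 F2 Gamma F) (hLambda : attractor F Lambda) :
  forall p : int -> sign, admissible F Gamma Lambda p ->
    exists! P : plane R, Lambda P /\ itinerary F Gamma p P.
Proof.
case: hF => -[_ [lambda [Ku [Ks [KuP [KsP]]]]]].
case=> -[l1 [KuKs _ axis_s] _ _] [[inv1 inv2] [exp1 exp2]] div hp paste _ _.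
case: div => -[a [da _] GE] hG; rewrite GE in hp paste hG * => {Gamma GE}.
set G := [set pt (a y) y | y in [set: R]] in hp paste hG *.
case: hLambda => D [[_ Dtrap] _ Ddisk] [LE _].
have [M DM] := disk_closure_bounded Ddisk.
pose A P := cone_set (KuP P); pose B P := cone_set (KsP P).
have hyp F0 : F0 = F1 \/ F0 = F2 -> hyperbolic A B lambda F0 (diffeo_inv F0).
  by case=> ->; [exact: diffeo_hyperbolic inv1 exp1|exact: diffeo_hyperbolic inv2 exp2].
have AK P : A P `<=` cone_set Ku by case: (inv1 P).
have BK P : B P `<=` cone_set Ks by case: (inv1 P).
have Anz P : exists2 u, A P u & u != 0.
  by exists (cone_dir (KuP P)); [exact: cone_set_dir|exact: cone_dir_neq0].
have Bnz P : exists2 u, B P u & u != 0.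
  by exists (cone_dir (KsP P)); [exact: cone_set_dir|exact: cone_dir_neq0].
have Kcap : cone_set Ku `&` cone_set Ks `<=` [set 0] by rewrite KuKs.
have Kcap' : cone_set Ks `&` cone_set Ku `<=` [set 0] by rewrite setIC.
pose c t := pt (a t) t; pose c' t := pt (derive1 a t) 1.
have Gc t : G (c t) by exists t.
have dc (t : R) : is_derive t 1 c (c' t).
  by apply: is_derive_pt; split; [exact: da|rewrite derive1E].
have c'0 t : c' t != 0.
  apply/eqP => /(congr1 (@ycoord R)); rewrite ycoord_pt /ycoord mxE => /eqP.
  by rewrite oner_eq0.
have c'B t : B (c t) (c' t).
  by have [_ h _ _] := hG _ (Gc t); apply: h; exact: tangent_vector_curve.
have cP : proper_curve c by exact: graph_proper.
have [_ _ exF1 exF1'] := hyp F1 (or_introl erefl).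
pose d := F1 \o c; pose d' t := 'd F1 (c t) (c' t).
have dd (t : R) : is_derive t 1 d (d' t).
  by apply: is_derive_comp_diff => //; exact: (exF1 _).1.
have d'0 t : d' t != 0.
  exact: (diff_neq0 (@diffeo_mapK _ F1) (exF1 (c t)).1 (exF1' _).1).
have d'A t : A (d t) (d' t).
  have [_ _ h _] := hG _ (Gc t); apply: h.
  by apply: (tangent_vector_curve (c := d)) => // s; exists (c s).
have dP : proper_curve d.
  apply: proper_comp cP; first exact: diffeo_mapK.
  by move=> P; apply: differentiable_continuous; exact: (diffeo_inv_C1 F1).1.
(* A chord of the image of the divider lies in the unstable universal cone, hence
   is not vertical: the y-axis is contained in the stable one. *)
have injF : injective F.
  apply: pasted_map_inj hp paste _ _.
    by move=> P /hG[].
  move=> _ _ /set_mem[_ [s _ <-] <-] /set_mem[_ [t _ <-] <-] e.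
  apply/eqP; rewrite -subr_eq0; apply/eqP.
  suff /Kcap : (cone_set Ku `&` cone_set Ks) (F1 (c s) - F1 (c t)) by [].
  split.
    apply: (chord_in_cone (c := d) (c' := d')) => //; first exact: closed_cone_set.
    by move=> r; exact: AK.
  have : (@y_axis R) (F1 (c s) - F1 (c t)).
    by rewrite /y_axis /= !coordE e subrr.
  rewrite -axis_s => -[r _ <-]; apply: (closed_cone_set Ks).2.
  exact: cone_set_dir.
have FD P : D P -> D (F P).
  move=> DP; apply: interior_subset; apply: Dtrap.
  by exists P => //; exact: subset_closure.
have iterD n P : D P -> D (iter n F P) by move=> DP; elim: n => //= n; exact: FD.
(* A point of the attractor has an [n]-th preimage in [D], and by injectivity the
   backward orbit runs through the forward orbit of this preimage. *)
have preimage n P : Lambda P -> exists2 Y, D Y & iter n F Y = P.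
  by rewrite LE => /(_ n I)[Y DY YP]; exists Y.
have pinvD n P : Lambda P -> D (iter n (pinv setT F) P).
  by move=> /(preimage n)[Y DY <-]; rewrite iter_shift// subnn.
have FpinvE n P : Lambda P ->
    F (iter n.+1 (pinv setT F) P) = iter n (pinv setT F) P.
  move=> /(preimage n.+1)[Y DY <-]; rewrite !iter_shift// subnn subSnn//.
move=> p [P LP iP]; exists P; split => // Q [LQ iQ].
have PQs : cone_set Ks (P - Q).
  apply: (bounded_orbits_chord (closed_cone_set Ku) (closed_cone_set Ks) Kcap
    AK BK Anz dc c'0 c'B cP (X := fun n => iter n F P) (Y := fun n => iter n F Q)
    l1 (M := M)) => n.
  - by apply/DM/iterD; have [Y DY <-] := preimage 0%N _ LP.
  - by apply/DM/iterD; have [Y DY <-] := preimage 0%N _ LQ.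
  - have [F0 [F0E eP eQ]] := same_branch n paste iP iQ.
    exists F0, (diffeo_inv F0).
    by split; [exact: hyp|exact: esym eP|exact: esym eQ].
have PQu : cone_set Ku (P - Q).
  apply: (bounded_orbits_chord (closed_cone_set Ks) (closed_cone_set Ku) Kcap'
    BK AK Bnz dd d'0 d'A dP (X := fun n => iter n (pinv setT F) P)
    (Y := fun n => iter n (pinv setT F) Q) l1 (M := M)) => n.
  - exact/DM/pinvD.
  - exact/DM/pinvD.
  - have [F0 [F0E eP eQ]] := same_branch (Negz n) paste iP iQ.
    exists (diffeo_inv F0), F0; split; first exact/hyperbolic_sym/hyp.
    + by rewrite -(FpinvE n P LP) eP diffeo_mapK.
    + by rewrite -(FpinvE n Q LQ) eQ diffeo_mapK.
by apply/eqP; rewrite -subr_eq0; apply/eqP; exact: (Kcap (P - Q)).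
Qed.
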